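(* Suppose $\|\mathbf a\|\le\|\mathbf d\|=1$. Let $\Gamma:D^m\to D^n$ be such that $C_\Gamma$ is a full-dimensional maximal $Q_h$-free set. Then $C^G_\Gamma\cap H$ is a full-dimensional maximal $Q_g$-free set if and only if $\mathbf a\ne\Gamma(-\mathbf d)$.
   Context: Fix integers $n,m\ge 1$ and $(\mathbf a,\mathbf d)\in\mathbb R^n\times\mathbb R^m$ with $\max\{\|\mathbf a\|,\|\mathbf d\|\}=1$, where $\|\cdot\|$ is the Euclidean norm. Define $Q_h=\{(\mathbf x,\mathbf y)\in\mathbb R^n\times\mathbb R^m:\|\mathbf x\|\le\|\mathbf y\|\}$, $H=\{(\mathbf x,\mathbf y)\in\mathbb R^n\times\mathbb R^m:\mathbf a^\top\mathbf x+\mathbf d^\top\mathbf y=-1\}$, and $Q_g=Q_h\cap H$. A closed convex set $C\subseteq\mathbb R^n\times\mathbb R^m$ is $Q_h$-free if its interior is disjoint from $Q_h$; it is maximal $Q_h$-free if it is $Q_h$-free and not a strict subset of another $Q_h$-free set; it is full-dimensional if it has dimension $n+m$. A set $K\subseteq H$ is full-dimensional if it has dimension $n+m-1$. A full-dimensional closed convex set $K\subseteq H$ is $Q_g$-free if its relative interior is disjoint from $Q_g$; it is maximal $Q_g$-free if it is $Q_g$-free and not a strict subset of another $Q_g$-free set contained in $H$. Let $D^k=\{\mathbf x\in\mathbb R^k:\|\mathbf x\|=1\}$. For $\Gamma:D^m\to D^n$ and $I\subseteq D^m$, let $C^I_\Gamma=\{(\mathbf x,\mathbf y)\in\mathbb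 R^n\times\mathbb R^m: -\Gamma(\boldsymbol\beta)^\top\mathbf x+\boldsymbol\beta^\top\mathbf y\le 0\ \ \forall\,\boldsymbol\beta\in I\}$, $C_\Gamma=C^{D^m}_\Gamma$, and $G=G(\Gamma,\mathbf a,\mathbf d)=\{\boldsymbol\beta\in D^m:\mathbf a^\top\Gamma(\boldsymbol\beta)+\mathbf d^\top\boldsymbol\beta\le 0\}$. *)

(* Defs.v *)
From HB Require Import structures.
From mathcomp Require Import all_boot all_order all_algebra.
From mathcomp Require Import all_classical all_reals all_analysis.
Import Order.TTheory GRing.Theory Num.Theory numFieldNormedType.Exports.

Set Implicit Arguments.
Unset Strict Implicit.
Unset Printing Implicit Defensive.

Local Open Scope classical_set_scope.
Local Open Scope ring_scope.

(* Points are column vectors.  The library norm [`|_|] on matrices and on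
   products is a maximum norm, so the Euclidean norm is defined here; the
   library topology on ['cV_n * 'cV_m] is the usual one. *)

Definition dotp (R : realType) (k : nat) (u v : 'cV[R]_k) : R :=
  (u^T *m v) 0 0.

Definition enorm (R : realType) (k : nat) (u : 'cV[R]_k) : R :=
  Num.sqrt (\sum_(i < k) u i 0 ^+ 2).

Definition sphere (R : realType) (k : nat) : set 'cV[R]_k :=
  [set u | enorm u = 1].

Definition aff_hull (R : realType) (V : lmodType R) (S : set V) : set V :=
  [set x | exists (k : nat) (p : 'I_k -> V) (l : 'I_k -> R),
     [/\ forall i, S (p i), \sum_i l i = 1 & x = \sum_i l i *: p i]].

(* S is nonempty and has dimension k: its affine hull is a translate of a
   k-dimensional linear subspace. *)
Definition has_dim (R : realType) (V : vectType R) (S : set V) (k : nat) :=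
  exists (x0 : V) (U : {vspace V}),
    \dim U = k /\ aff_hull S = [set x | x - x0 \in U].

Definition relint (R : realType) (V : normedModType R) (S : set V) : set V :=
  [set x | S x /\ \forall y \near x, aff_hull S y -> S y].

Section QuadraticFree.
Variables (R : realType) (n m : nat).
Local Notation V := ('cV[R]_n * 'cV[R]_m)%type.
Implicit Types (C K : set V) (a : 'cV[R]_n) (d : 'cV[R]_m).
Implicit Types (Gamma : 'cV[R]_m -> 'cV[R]_n) (I : set 'cV[R]_m).

Definition Qh : set V := [set z | enorm z.1 <= enorm z.2].

Definition hyperplane a d : set V := [set z | dotp a z.1 + dotp d z.2 = -1].

Definition Qg a d : set V := Qh `&` hyperplane a d.

Definition Qh_free C :=
  [/\ closed C, convex_set C & interior C `&` Qh = set0].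

Definition maximal_Qh_free C :=
  Qh_free C /\ forall C', Qh_free C' -> ~ (C `<` C').

Definition full_dim C := has_dim C (n + m).

Definition full_dim_in_hyperplane a d K :=
  K `<=` hyperplane a d /\ has_dim K (n + m - 1).

Definition Qg_free a d K :=
  [/\ full_dim_in_hyperplane a d K, closed K, convex_set K
    & relint K `&` Qg a d = set0].

Definition maximal_Qg_free a d K :=
  Qg_free a d K /\ forall K', Qg_free a d K' -> ~ (K `<` K').

(* Gamma is a function on the whole space, but only its values on the sphere
   matter, as I is always taken to be a subset of the sphere. *)
Definition Cset Gamma I : set V :=
  [set z | forall b, I b -> - dotp (Gamma b) z.1 + dotp b z.2 <= 0].

Definition Gset Gamma a d : set 'cV[R]_m :=
  [set b | sphere b /\ dotp a (Gamma b) + dotp d b <= 0].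

End QuadraticFree.

(* Main.v *)
Require Import Defs.
From HB Require Import structures.
From mathcomp Require Import all_boot all_order all_algebra.
From mathcomp Require Import all_classical all_reals all_analysis.
From mathcomp Require Import ring lra.
Import Order.TTheory GRing.Theory Num.Theory numFieldNormedType.Exports.
Local Open Scope classical_set_scope.
Local Open Scope ring_scope.

Set Implicit Arguments.
Unset Strict Implicit.
Unset Printing Implicit Defensive.

(** Write [C] for the cone [C_Gamma] and [p_b := (-Gamma b, b)] for its normals.

  The key point is that maximality of [C] forces every [(Gamma b, b)] to lie in
  [C], that is, [Gamma] is nonexpansive.  Suppose [z := (Gamma b0, b0)] is not
  in [C], let [q] be interior to [C], and let [z1] be the last point of [C] on
  the segment from [q] to [z].  Relaxing [C] so as to include points of the
  segment slightly beyond [z1] breaks [Qh]-freeness, by maximality; in the limit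
  this yields [b] with [(Gamma b, b)] in [C] and [p_b] vanishing at [z1].  But
  [p_b] is nonpositive at [z], being there equal to the value of [p_b0] at
  [(Gamma b, b)], and negative at [q].

  If [a <> Gamma (- d)], the interior of [C] meets [H], which makes the section
  [K] full-dimensional.  It is [Qg]-free: for [(x, y)] in [Qg] with
  [y / |y|] outside [G], the path from [y] to [- d] has a point on the boundary of
  [G] whose normal is violated at [(x, y)].  It is maximal: if a larger [K']
  contains a point violating [p_b] for some [b] in [G], moving that point far in
  the direction [(Gamma b, b)] and rescaling back to [H] gives a point of [Qg]
  in the relative interior of [K'].  If [a = Gamma (- d)], the inequality of
  [- d] reads [1 <= 0] on [H], so [K] is empty. *)

(** * Euclidean product *)

Section EuclideanProduct.
Variables (R : realType) (k : nat).
Implicit Types (u v w : 'cV[R]_k) (c : R).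

Lemma dotpE u v : dotp u v = \sum_i u i 0 * v i 0.
Proof. by rewrite /dotp mxE; apply: eq_bigr => i _; rewrite mxE. Qed.

Lemma dotpC u v : dotp u v = dotp v u.
Proof. by rewrite !dotpE; apply: eq_bigr => i _; rewrite mulrC. Qed.

Lemma dotpDr u v w : dotp u (v + w) = dotp u v + dotp u w.
Proof. by rewrite /dotp mulmxDr mxE. Qed.

Lemma dotpZr c u v : dotp u (c *: v) = c * dotp u v.
Proof. by rewrite /dotp -scalemxAr mxE. Qed.

Lemma dotpNr u v : dotp u (- v) = - dotp u v.
Proof. by rewrite -scaleN1r dotpZr mulN1r. Qed.

Lemma dotpDl u v w : dotp (v + w) u = dotp v u + dotp w u.
Proof. by rewrite dotpC dotpDr !(dotpC u). Qed.

Lemma dotpZl c u v : dotp (c *: u) v = c * dotp u v.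
Proof. by rewrite dotpC dotpZr dotpC. Qed.

Lemma dotpNl u v : dotp (- u) v = - dotp u v.
Proof. by rewrite dotpC dotpNr dotpC. Qed.

Lemma dotp0 u : dotp u 0 = 0.
Proof. by rewrite -(scale0r 0) dotpZr mul0r. Qed.

Lemma dotpp_ge0 u : 0 <= dotp u u.
Proof. by rewrite dotpE; apply: sumr_ge0 => i _; rewrite -expr2 sqr_ge0. Qed.

Lemma dotpp_eq0 u : (dotp u u == 0) = (u == 0).
Proof.
apply/idP/eqP => [|->]; last by rewrite dotp0.
rewrite dotpE psumr_eq0 => [/allP u0|i _]; last by rewrite -expr2 sqr_ge0.
apply/colP => i; rewrite mxE; apply/eqP.
by have := u0 i (mem_index_enum _); rewrite /= mulf_eq0 orbb.
Qed.

Lemma sqr_enorm u : enorm u ^+ 2 = dotp u u.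
Proof.
rewrite sqr_sqrtr ?dotpE; first by apply: eq_bigr => i _; rewrite expr2.
by apply: sumr_ge0 => i _; rewrite sqr_ge0.
Qed.

Lemma enorm_ge0 u : 0 <= enorm u.
Proof. exact: sqrtr_ge0. Qed.

Lemma enorm_eq0 u : (enorm u == 0) = (u == 0).
Proof. by rewrite -dotpp_eq0 -sqr_enorm sqrf_eq0. Qed.

Lemma enormZ c u : enorm (c *: u) = `|c| * enorm u.
Proof.
apply/eqP; rewrite -(@eqrXn2 _ 2) ?mulr_ge0 ?enorm_ge0 //.
rewrite sqr_enorm dotpZr dotpZl mulrA -expr2 exprMn real_normK ?num_real //.
by rewrite sqr_enorm.
Qed.

Lemma enormN u : enorm (- u) = enorm u.
Proof. by rewrite -scaleN1r enormZ normrN1 mul1r. Qed.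

Lemma sphereP u : sphere u <-> dotp u u = 1.
Proof.
rewrite -sqr_enorm /sphere /=; split => [->|]; first by rewrite expr1n.
by move/eqP; rewrite sqrp_eq1 ?enorm_ge0 // => /eqP.
Qed.

(** Cauchy-Schwarz: the square of [dotp v v *: u - dotp u v *: v] is [dotp v v] times the gap
    between the two squared sides. *)
Lemma dotp_le_enorm u v : dotp u v <= enorm u * enorm v.
Proof.
have [->|v0] := eqVneq v 0.
  by rewrite dotp0 mulr_ge0 ?enorm_ge0.
have vv : 0 < dotp v v by rewrite lt_def dotpp_ge0 dotpp_eq0 v0.
suff le2 : dotp u v ^+ 2 <= (enorm u * enorm v) ^+ 2.
  apply: le_trans (ler_norm _) _.
  by rewrite -ler_sqr ?nnegrE ?mulr_ge0 ?enorm_ge0 // real_normK ?num_real.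
rewrite exprMn !sqr_enorm -subr_ge0 -(pmulr_rge0 _ vv).
have := dotpp_ge0 (dotp v v *: u - dotp u v *: v).
rewrite !(dotpDl, dotpDr, dotpZl, dotpZr, dotpNl, dotpNr) (dotpC v u).
congr (0 <= _); ring.
Qed.

(** Equality case of Cauchy-Schwarz: the square of [v - u] is at most [1 - 2 + 1]. *)
Lemma sphere_dotp_ge1 u v : sphere u -> enorm v <= 1 -> 1 <= dotp u v -> v = u.
Proof.
move=> /sphereP u1 v1 uv; apply/eqP.
rewrite -subr_eq0 -dotpp_eq0 eq_le dotpp_ge0 andbT.
have : dotp v v <= 1 by rewrite -sqr_enorm expr_le1 ?enorm_ge0.
rewrite !(dotpDl, dotpDr, dotpNl, dotpNr) (dotpC v u) u1; lra.
Qed.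

(** Convergence is asked coordinatewise, the form in which ultrafilter limits are obtained below. *)
Lemma cvg_dotp (T : Type) (F : set_system T) {FF : Filter F}
    (f g : T -> 'cV[R]_k) (u v : 'cV[R]_k) :
  (forall i, f t i 0 @[t --> F] --> u i 0) ->
  (forall i, g t i 0 @[t --> F] --> v i 0) ->
  dotp (f t) (g t) @[t --> F] --> dotp u v.
Proof.
move=> fu gv; rewrite dotpE; under eq_fun do rewrite dotpE.
apply: (cvg_big (@add_continuous R)) => i _.
exact: cvgM (fu i) (gv i).
Qed.

Lemma dotp_continuous u : continuous (dotp u : 'cV[R]_k -> R).
Proof.
move=> v; have FF := @nbhs_filter _ v.
apply: (@cvg_dotp _ (nbhs v) _ (fun=> u)) => i; first exact: cvg_cst.
exact: coord_continuous.
Qed.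

End EuclideanProduct.

Lemma le_enorm (R : realType) (k l : nat) (u : 'cV[R]_k) (v : 'cV[R]_l) :
  (enorm u <= enorm v) = (dotp u u <= dotp v v).
Proof. by rewrite -(sqr_enorm u) -(sqr_enorm v) ler_sqr // nnegrE enorm_ge0. Qed.

(** * Affine hulls and neighbourhoods *)

Section Convexity.
Variable R : realType.

Lemma convex_set_comb (M : lmodType R) (A : set M) :
  convex_set (A : set (convex_lmodType M)) <->
  forall x y t, 0 <= t -> t <= 1 -> A x -> A y -> A (t *: x + (1 - t) *: y).
Proof.
split=> [cA x y t t0 t1 Ax Ay|cA x y t].
  have t01 : 0 <= t <= 1 by rewrite t0 t1.
  have := cA x y (Itv01 t0 t1); rewrite !inE => /(_ Ax Ay).
  by [].
rewrite !inE => Ax Ay; apply: (cA) => //.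
Qed.

Lemma aff_hull_line (M : lmodType R) (A : set M) x y t :
  A x -> A y -> aff_hull A (x + t *: (y - x)).
Proof.
move=> Ax Ay; exists 2%N, (fun i => if i == 0 then x else y),
  (fun i => if i == 0 then 1 - t else t); split=> [i||].
- by case: ifP.
- by rewrite big_ord_recl big_ord1 /= subrK.
- rewrite big_ord_recl big_ord1 /= scalerBl scale1r scalerBr.
  by rewrite [t *: y - _]addrC addrA.
Qed.

Lemma near0_scale (M : normedModType R) (P : set M) (c : R) :
  (\forall w \near 0, P w) -> \forall w \near 0, P (c *: w).
Proof.
have : (fun w : M => c *: w) @ 0 --> (0 : M).
  rewrite -[X in _ --> X](scaler0 M c).
  by apply: cvgZl_tmp; exact: cvg_id.
exact.
Qed.

Lemma near0_dir (M : normedModType R) (P : set M) (w : M) :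
  (\forall w \near 0, P w) -> exists2 e : R, 0 < e & P (e *: w).
Proof.
move=> P0.
have cw : (fun e : R => e *: w) @ 0 --> (0 : M).
  rewrite -[X in _ --> X](scale0r w).
  by apply: cvgZr_tmp; exact: cvg_id.
have /nbhs_ballP[r /= r0 rP] := cw _ P0.
exists (r / 2); first by rewrite divr_gt0.
apply: rP; rewrite /ball/= sub0r normrN gtr0_norm ?divr_gt0 //; lra.
Qed.

End Convexity.

(** * The Euclidean product on pairs *)

Section Pairing.
Variables (R : realType) (n m : nat).
Local Notation V := ('cV[R]_n * 'cV[R]_m)%type.
Implicit Types (p z w : V) (c : R) (C : set V).

Definition pdot p z : R := dotp p.1 z.1 + dotp p.2 z.2.

Lemma pdotC p z : pdot p z = pdot z p.
Proof. by rewrite /pdot !(dotpC p.1) !(dotpC p.2). Qed.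

Lemma pdotDr p z w : pdot p (z + w) = pdot p z + pdot p w.
Proof. by rewrite /pdot !dotpDr addrACA. Qed.

Lemma pdotZr c p z : pdot p (c *: z) = c * pdot p z.
Proof. by rewrite /pdot !dotpZr mulrDr. Qed.

Lemma pdotNr p z : pdot p (- z) = - pdot p z.
Proof. by rewrite -scaleN1r pdotZr mulN1r. Qed.

Lemma pdotDl p z w : pdot (z + w) p = pdot z p + pdot w p.
Proof. by rewrite pdotC pdotDr !(pdotC p). Qed.

Lemma pdotZl c p z : pdot (c *: z) p = c * pdot z p.
Proof. by rewrite pdotC pdotZr pdotC. Qed.

Lemma pdotNl p z : pdot (- z) p = - pdot z p.
Proof. by rewrite pdotC pdotNr pdotC. Qed.

Definition pdotE := (pdotDr, pdotZr, pdotNr, pdotDl, pdotZl, pdotNl).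

Lemma pdot_sum p k (l : 'I_k -> R) (f : 'I_k -> V) :
  pdot p (\sum_i l i *: f i) = \sum_i l i * pdot p (f i).
Proof.
apply: (big_ind2 (fun z c => pdot p z = c)).
- by rewrite /pdot !dotp0 addr0.
- by move=> z1 c1 z2 c2 h1 h2; rewrite pdotDr h1 h2.
- by move=> i _; rewrite pdotZr.
Qed.

Lemma pdotpp_gt0 p : p != 0 -> 0 < pdot p p.
Proof.
move=> p0; rewrite ltNge; apply: contra p0; rewrite /pdot => h.
have h1 := dotpp_ge0 p.1; have h2 := dotpp_ge0 p.2.
have /eqP : dotp p.1 p.1 = 0 by lra.
have /eqP : dotp p.2 p.2 = 0 by lra.
rewrite !dotpp_eq0 => /eqP p2 /eqP p1.
by apply/eqP; rewrite [LHS]surjective_pairing p1 p2.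
Qed.

Lemma cvg_pdot (T : Type) (F : set_system T) {FF : Filter F}
    (f g : T -> V) (p z : V) :
  (forall i, (f t).1 i 0 @[t --> F] --> p.1 i 0) ->
  (forall i, (f t).2 i 0 @[t --> F] --> p.2 i 0) ->
  (forall i, (g t).1 i 0 @[t --> F] --> z.1 i 0) ->
  (forall i, (g t).2 i 0 @[t --> F] --> z.2 i 0) ->
  pdot (f t) (g t) @[t --> F] --> pdot p z.
Proof. by move=> f1 f2 g1 g2; apply: cvgD; apply: cvg_dotp. Qed.

Lemma pdot_continuous p : continuous (pdot p : V -> R).
Proof.
move=> z; apply: cvgD.
  by apply: (@cvg_comp _ _ _ fst); [exact: cvg_fst|exact: dotp_continuous].
by apply: (@cvg_comp _ _ _ snd); [exact: cvg_snd|exact: dotp_continuous].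
Qed.

Lemma closed_pdot_le p c : closed [set z | pdot p z <= c].
Proof.
rewrite (_ : mkset _ = pdot p @^-1` [set x | x <= c]) //.
by apply: closed_comp; [move=> z _; exact: pdot_continuous|exact: closed_le].
Qed.

(** A small step from [z] along [p] itself stays in [C] and raises the value by a positive multiple
    of [pdot p p]. *)
Lemma pdot_interior_lt0 C p z : p != 0 -> (forall x, C x -> pdot p x <= 0) ->
  interior C z -> pdot p z < 0.
Proof.
move=> /pdotpp_gt0 pp Cp Cz.
have Cz0 : \forall w \near (0 : V), C (z + w).
  move: Cz; rewrite /interior /= -[X in nbhs X]addr0 => h.
  have : (fun w : V => z + w) @ (0 : V) --> z + 0.
    by apply: cvgD; [exact: cvg_cst|exact: cvg_id].
  exact.
have [e e0 /Cp] := near0_dir p Cz0.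
rewrite pdotDr pdotZr; nra.
Qed.

Lemma Qh_dotp z : Qh z <-> dotp z.1 z.1 <= dotp z.2 z.2.
Proof. by rewrite /Qh /= le_enorm. Qed.

Lemma sum_coord z :
  z = \sum_(i : 'I_n + 'I_m)
    (match i with inl i => z.1 i 0 | inr j => z.2 j 0 end) *:
    (match i with inl i => (delta_mx i 0, 0) | inr j => (0, delta_mx j 0) end : V).
Proof.
have fstS (I : finType) (F : I -> V) : (\sum_i F i).1 = \sum_i (F i).1.
  exact: (big_morph fst).
have sndS (I : finType) (F : I -> V) : (\sum_i F i).2 = \sum_i (F i).2.
  exact: (big_morph snd).
have col_sum k (u : 'cV[R]_k) : \sum_i u i 0 *: delta_mx i 0 = u.
  rewrite [RHS]matrix_sum_delta; apply: eq_bigr => i _.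
  by rewrite big_ord1.
rewrite big_sumType /= [LHS]surjective_pairing [RHS]surjective_pairing /=.
congr pair; rewrite ?fstS ?sndS /=.
  rewrite [X in _ + X]big1 ?addr0 ?col_sum // => i _; exact: scaler0.
rewrite [X in X + _]big1 ?add0r ?col_sum // => i _; exact: scaler0.
Qed.
End Pairing.

(** * Interior points of full-dimensional cones *)

Section Core.
Variables (R : realType) (n m : nat).
Local Notation V := ('cV[R]_n * 'cV[R]_m)%type.
Implicit Types (p z w : V) (c : R) (C : set V).

(** Each basis vector is a combination of points of [C]. The sum [q] of all these points absorbs a
    small [w]: the coefficients of [q + w] on them are [1] plus a small number, hence
    nonnegative. *)
Lemma cone_core C : C 0 -> (forall x y, C x -> C y -> C (x + y)) ->
  (forall c x, 0 <= c -> C x -> C (c *: x)) -> aff_hull C = setT ->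
  exists q, \forall w \near (0 : V), C (q + w).
Proof.
move=> C0 CD CZ CT.
pose f (i : 'I_n + 'I_m) z :=
  match i with inl i => z.1 i 0 | inr j => z.2 j 0 end.
pose e (i : 'I_n + 'I_m) : V :=
  match i with inl i => (delta_mx i 0, 0) | inr j => (0, delta_mx j 0) end.
have f_cont i : f i w @[w --> (0 : V)] --> (0 : R).
  have -> : (0 : R) = f i 0 by case: i => i /=; rewrite mxE.
  case: i => i.
    by apply: (@cvg_comp _ _ _ fst (fun u : 'cV[R]_n => u i 0));
      [exact: cvg_fst|exact: coord_continuous].
  by apply: (@cvg_comp _ _ _ snd (fun u : 'cV[R]_m => u i 0));
    [exact: cvg_snd|exact: coord_continuous].
have /choice[g gP] i : exists g : {k & ('I_k -> V) * ('I_k -> R)}%type,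
    (forall j, C ((projT2 g).1 j)) /\
    e i = \sum_j (projT2 g).2 j *: (projT2 g).1 j.
  have : aff_hull C (e i) by rewrite CT.
  by move=> [k [x [l [Cx _ ->]]]]; exists (existT _ k (x, l)).
pose p i := (projT2 (g i)).1; pose l i := (projT2 (g i)).2.
exists (\sum_i \sum_j p i j).
have small : \forall w \near (0 : V), forall i j, `|f i w * l i j| < 1.
  have FF : Filter (nbhs (0 : V)) by exact: nbhs_filter.
  apply: (@filter_forall _ _ (fun i w => forall j, `|f i w * l i j| < 1) _ FF) => i.
  apply: (@filter_forall _ _ (fun j w => `|f i w * l i j| < 1) _ FF) => j.
  have : f i w * l i j @[w --> (0 : V)] --> 0 * l i j.
    by apply: cvgM; [exact: f_cont|exact: cvg_cst].
  by rewrite mul0r => /cvgr0Pnorm_lt; apply.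
near=> w.
have -> : \sum_i \sum_j p i j + w = \sum_i \sum_j (1 + f i w * l i j) *: p i j.
  rewrite [w in LHS]sum_coord -big_split; apply: eq_bigr => i _ /=.
  rewrite -/(e i) -/(f i w) (gP i).2 scaler_sumr -big_split.
  by apply: eq_bigr => j _ /=; rewrite scalerDl scale1r scalerA.
apply: big_ind => // i _; apply: big_ind => // j _.
apply: CZ; last exact: (gP i).1.
have : forall i j, `|f i w * l i j| < 1 by near: w.
move=> /(_ i j); rewrite ltr_norml; lra.
Unshelve. all: by end_near.
Qed.

End Core.

(** * The cone of Gamma *)

(** An ultrafilter concentrated on a compact interval has a cluster point and converges to it. This
    does the work of extracting convergent subsequences. *)
Lemma ultra_bounded_cvg (R : realType) (T : Type) (G : set_system T) (u : T -> R)
    (M : R) :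
  UltraFilter G -> G [set t | `|u t| <= M] -> exists l : R, u t @[t --> G] --> l.
Proof.
move=> UG GM.
have GI : G (u @^-1` `[- M, M]%classic).
  by apply: filterS GM => t; rewrite /= in_itv /= -ler_norml.
have [l [_ cl]] := @segment_compact _ (- M) M (u @ G) _ GI.
exists l => A lA; have [//|GA] := in_ultra_setVsetC (u @^-1` A) UG.
by have [? [/=]] := cl (~` A) A GA lA.
Qed.

Lemma coord_le_enorm (R : realType) k (u : 'cV[R]_k) i : `|u i 0| <= enorm u.
Proof.
rewrite -ler_sqr ?nnegrE ?enorm_ge0 // sqr_enorm real_normK ?num_real //.
rewrite dotpE (bigD1 i) //= -expr2 lerDl.
by apply: sumr_ge0 => j _; rewrite -expr2 sqr_ge0.
Qed.

Lemma ultra_bounded_cvg_col (R : realType) k (T : Type) (G : set_system T)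
    (u : T -> 'cV[R]_k) :
  UltraFilter G -> G [set t | enorm (u t) <= 1] ->
  exists l : 'cV[R]_k, forall i, u t i 0 @[t --> G] --> l i 0.
Proof.
move=> UG G1.
have /choice[l lP] i : exists l : R, u t i 0 @[t --> G] --> l.
  apply: (ultra_bounded_cvg (M := 1)) => //.
  by apply: filterS G1 => t /=; apply: le_trans; exact: coord_le_enorm.
by exists (\col_i l i) => i; rewrite mxE.
Qed.

Section Cset.
Variables (R : realType) (n m : nat) (Gamma : 'cV[R]_m -> 'cV[R]_n).
Hypothesis Gamma_sphere : forall b, sphere b -> sphere (Gamma b).
Local Notation V := ('cV[R]_n * 'cV[R]_m)%type.
Implicit Types (p z w q : V) (c : R) (C : set V) (I : set 'cV[R]_m) (b : 'cV[R]_m).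

Definition normal b : V := (- Gamma b, b).

Lemma pdot_normal b z : pdot (normal b) z = - dotp (Gamma b) z.1 + dotp b z.2.
Proof. by rewrite /pdot dotpNl. Qed.

Lemma CsetE I : Cset Gamma I = [set z | forall b, I b -> pdot (normal b) z <= 0].
Proof. by apply/seteqP; split=> z hz b Ib; have := hz b Ib; rewrite pdot_normal. Qed.

Lemma Cset0 I : Cset Gamma I 0.
Proof. by rewrite CsetE => b _; rewrite pdot_normal !dotp0 oppr0 addr0. Qed.

Lemma CsetD I z w : Cset Gamma I z -> Cset Gamma I w -> Cset Gamma I (z + w).
Proof.
rewrite CsetE => hz hw b Ib; rewrite pdotDr.
by have := hz b Ib; have := hw b Ib; lra.
Qed.

Lemma CsetZ I c z : 0 <= c -> Cset Gamma I z -> Cset Gamma I (c *: z).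
Proof. by rewrite CsetE => c0 hz b Ib; rewrite pdotZr; have := hz b Ib; nra. Qed.

(** The family [P] is arbitrary so as to cover the enlarged cone of [maximal_separation] as well. *)
Lemma closed_cone_of (P : set V) : closed [set z | forall p, P p -> pdot p z <= 0].
Proof.
rewrite (_ : mkset _ = \bigcap_(p in P) [set z | pdot p z <= 0]) //.
by apply: closed_bigI => p _; exact: closed_pdot_le.
Qed.

Lemma convex_cone_of (P : set V) :
  convex_set ([set z | forall p, P p -> pdot p z <= 0] : set (convex_lmodType V)).
Proof.
apply/convex_set_comb => x y t t0 t1 hx hy p Pp.
by rewrite !pdotE; have := hx p Pp; have := hy p Pp; nra.
Qed.

Lemma Cset_cone_of I :
  Cset Gamma I = [set z | forall p, [set normal b | b in I] p -> pdot p z <= 0].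
Proof.
rewrite CsetE; apply/seteqP; split=> z hz; first by move=> _ [b Ib <-]; exact: hz.
by move=> b Ib; apply: hz; exists b.
Qed.

Lemma normal_neq0 b : sphere b -> normal b != 0.
Proof.
move=> /sphereP b1; apply/eqP => -[_ b0].
by move: b1; rewrite b0 dotp0 => /esym/eqP; rewrite oner_eq0.
Qed.

End Cset.

(** * Maximality implies nonexpansiveness *)

Section Nonexpansive.
Variables (R : realType) (n m : nat) (Gamma : 'cV[R]_m -> 'cV[R]_n).
Hypothesis Gamma_sphere : forall b, sphere b -> sphere (Gamma b).
Local Notation V := ('cV[R]_n * 'cV[R]_m)%type.
Implicit Types (p z w q s : V) (c t : R) (b : 'cV[R]_m).

Let C : set V := Cset Gamma (@sphere R m).
(** The polar cone of [C]: it contains the normals, and also their limits and conic combinations. *)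
Let valid p := forall z, C z -> pdot p z <= 0.
Local Notation normal := (normal Gamma).

Lemma valid_normal b : sphere b -> valid (normal b).
Proof. by move=> b1 z; rewrite /C CsetE; apply. Qed.

Lemma sphere_enorm_le1 k (u : 'cV[R]_k) : sphere u -> enorm u <= 1.
Proof. by move=> ->. Qed.

(** Keeping only the valid inequalities that hold at [z] gives a closed convex cone [D] strictly
    larger than [C]. By maximality its interior meets [Qh], and [s] is such a point, rescaled. *)
Lemma maximal_separation z : maximal_Qh_free C -> ~ C z ->
  (exists b, sphere b /\ pdot (normal b) z <= 0) ->
  exists s, [/\ enorm s.1 <= 1, sphere s.2 &
    forall p, p != 0 -> valid p -> pdot p z <= 0 -> pdot p s < 0].
Proof.
move=> [Cfree Cmax] nCz [b0 [b01 b0z]].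
pose D : set V := [set x | forall p, valid p /\ pdot p z <= 0 -> pdot p x <= 0].
have CD : C `<` D.
  split=> [x Cx p [vp _]|/(_ z) DC]; first exact: vp.
  by apply/nCz/DC => p [].
have [s [Ds Qs]] : exists s, (interior D `&` Qh (n := n) (m := m)) s.
  apply: contrapT => nD; apply: (Cmax D) CD; split.
  - exact: closed_cone_of.
  - exact: convex_cone_of.
  - by apply/seteqP; split=> // s Ds; apply: nD; exists s.
have sP p : p != 0 -> valid p -> pdot p z <= 0 -> pdot p s < 0.
  by move=> p0 vp pz; apply: (@pdot_interior_lt0 _ _ _ D) => // x; apply.
(* Otherwise [s] would be [0], where [normal b0] cannot be negative. *)
have s2 : 0 < enorm s.2.
  rewrite lt_def enorm_ge0 andbT; apply/negP => /eqP s20.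
  have /eqP : enorm s.1 = 0.
    by apply/eqP; rewrite eq_le enorm_ge0 andbT -s20.
  rewrite enorm_eq0 => /eqP s10; move/eqP: s20; rewrite enorm_eq0 => /eqP s20.
  have := sP _ (normal_neq0 Gamma b01) (valid_normal b01) b0z.
  by rewrite /pdot s10 s20 !dotp0 addr0 ltxx.
have is2 : 0 < (enorm s.2)^-1 by rewrite invr_gt0.
exists ((enorm s.2)^-1 *: s); split=> [||p p0 vp pz].
- by rewrite /= enormZ gtr0_norm // mulrC ler_pdivrMr // mul1r.
- by rewrite /sphere /= enormZ gtr0_norm // mulVf // gt_eqF.
- by rewrite pdotZr pmulr_rlt0 // sP.
Qed.

Lemma maximal_ray q : (\forall w \near (0 : V), C (q + w)) ->
  maximal_Qh_free C -> forall b, sphere b -> C (Gamma b, b).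
Proof.
move=> Cq Cmax b0 b01; apply: contrapT; set z : V := (Gamma b0, b0) => nCz.
have q_strict p : p != 0 -> valid p -> pdot p q < 0.
  move=> /pdotpp_gt0 p0 vp; have [e e0 /vp] := near0_dir p Cq.
  by rewrite !pdotE; nra.
have nq b : sphere b -> pdot (normal b) q < 0.
  by move=> b1; apply: q_strict; [exact: normal_neq0|exact: valid_normal].
(* [zt] runs from [z] at [0] to [q] at [1]; [ts] will be the parameter at which it enters [C]. *)
pose zt t := (1 - t) *: z + t *: q.
have b0z : pdot (normal b0) z = 0.
  move/sphereP: (Gamma_sphere b01); move/sphereP: b01.
  by rewrite pdot_normal /= => -> ->; rewrite addNr.
pose T := [set t | 0 <= t <= 1 /\ C (zt t)].
have T1 : T 1.
  split; first by rewrite ler01 lexx.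
  rewrite /zt subrr scale0r add0r scale1r.
  by have := nbhs_singleton Cq; rewrite addr0.
have T_lb : lbound T 0 by move=> t [/andP[]].
pose ts := inf T.
have ts0 : 0 <= ts by apply: lb_le_inf => //; exists 1.
have ts1 : ts <= 1 by apply: ge_inf => //; exists 0.
(* The quotient is the parameter at which [normal b] changes sign along [zt]; no element of [T] lies
   before it. *)
have ts_ge b : sphere b -> 0 < pdot (normal b) z ->
    pdot (normal b) z / (pdot (normal b) z - pdot (normal b) q) <= ts.
  move=> b1 bz; have bq := nq b b1; apply: lb_le_inf; first by exists 1.
  move=> t [/andP[t0 t1] /(valid_normal b1)]; rewrite !pdotE => h.
  by rewrite ler_pdivrMr; lra.
have Czts : C (zt ts).
  rewrite /C CsetE => b b1; have bq := nq b b1; rewrite !pdotE.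
  have [bz|bz] := leP (pdot (normal b) z) 0; first by nra.
  by have := ts_ge b b1 bz; rewrite ler_pdivrMr; lra.
have ts_gt0 : 0 < ts.
  have [b [b1 bz]] : exists b, sphere b /\ 0 < pdot (normal b) z.
    apply: contrapT => h; apply: nCz; rewrite /C CsetE => b b1.
    by rewrite leNgt; apply/negP => bz; apply: h; exists b.
  have bq := nq b b1; apply: lt_le_trans (ts_ge b b1 bz).
  by rewrite divr_gt0 //; lra.
have nCzt t : 0 <= t < ts -> ~ C (zt t).
  move=> /andP[t0 tts] Ct; have : ts <= t.
    apply: ge_inf; first by exists 0.
    by split=> //; rewrite t0 (le_trans (ltW tts)).
  by rewrite leNgt tts.
have nzt b t : pdot (normal b) (zt t) =
    (1 - t) * pdot (normal b) z + t * pdot (normal b) q.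
  by rewrite !pdotE.
(* [S t] is the separating point for [zt t]; outside the range it takes the dummy value [0]. *)
have /choice[S SP] t : exists s, 0 <= t < ts -> [/\ enorm s.1 <= 1, sphere s.2 &
    forall p, p != 0 -> valid p -> pdot p (zt t) <= 0 -> pdot p s < 0].
  have [t01|] := boolP (0 <= t < ts); last by exists 0.
  have [s sP] : exists s, [/\ enorm s.1 <= 1, sphere s.2 &
    forall p, p != 0 -> valid p -> pdot p (zt t) <= 0 -> pdot p s < 0].
    apply: maximal_separation => //; first exact: nCzt.
    exists b0; split=> //; rewrite nzt b0z; have := nq b0 b01; move: t01; nra.
  by exists s.
(* Refining the left neighbourhoods of [ts] to an ultrafilter makes all the bounded families below
   converge along it. *)
have [G [UG tsG]] := ultraFilterLemma (at_left_proper_filter ts).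
have FG : Filter G by exact: filter_filter.
have Gt : G [set t | 0 <= t < ts].
  apply: tsG; near=> t; rewrite /=; apply/andP; split; near: t.
    by apply: nbhs_left_ge.
  exact: nbhs_left_lt.
have Gid : t @[t --> G] --> ts.
  by move=> A tsA; apply: tsG; exact: (@cvg_within _ (nbhs ts)).
have GS (P : R -> Prop) : (forall t, 0 <= t < ts -> P t) -> G [set t | P t].
  by move=> h; apply: filterS Gt => t /h.
have [x xP] : exists x : 'cV[R]_n, forall i, (S t).1 i 0 @[t --> G] --> x i 0.
  by apply: ultra_bounded_cvg_col; apply: GS => t /SP[].
have [b bP] : exists b : 'cV[R]_m, forall i, (S t).2 i 0 @[t --> G] --> b i 0.
  by apply: ultra_bounded_cvg_col; apply: GS => t /SP[_ /sphere_enorm_le1].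
(* Continuity of [Gamma] is not yet available, so [g] is identified with [Gamma b] only later. *)
have [g gP] : exists g : 'cV[R]_n, forall i, Gamma (S t).2 i 0 @[t --> G] --> g i 0.
  apply: ultra_bounded_cvg_col; apply: GS => t /SP[_ s1 _].
  exact/sphere_enorm_le1/Gamma_sphere.
have le_lim (f : R -> R) l c : f t @[t --> G] --> l ->
    (forall t, 0 <= t < ts -> f t <= c) -> l <= c.
  by move=> fl fc; apply: (cvgr_to_le fl); exact: GS.
have ge_lim (f : R -> R) l c : f t @[t --> G] --> l ->
    (forall t, 0 <= t < ts -> c <= f t) -> c <= l.
  by move=> fl fc; apply: (cvgr_to_ge fl); exact: GS.
have b1 : sphere b.
  apply/sphereP/eqP; rewrite eq_le; have bb := @cvg_dotp _ _ _ _ FG _ _ _ _ bP bP.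
  by rewrite (le_lim _ _ _ bb) ?(ge_lim _ _ _ bb) // => t /SP[_ /sphereP -> _].
have x1 : enorm x <= 1.
  rewrite -(@expr_le1 _ 2) ?enorm_ge0 // sqr_enorm.
  apply: (le_lim _ _ _ (cvg_dotp xP xP)) => t /SP[s1 _ _].
  by rewrite -sqr_enorm expr_le1 ?enorm_ge0.
have g1 : enorm g <= 1.
  rewrite -(@expr_le1 _ 2) ?enorm_ge0 // sqr_enorm.
  apply: (le_lim _ _ _ (cvg_dotp gP gP)) => t /SP[_ s1 _].
  by have /sphereP -> := Gamma_sphere s1.
have comb_cvg (c c' : R) :
    (1 - t) * c + t * c' @[t --> G] --> (1 - ts) * c + ts * c'.
  apply: cvgD; apply: cvgM => //; try exact: cvg_cst.
  by apply: cvgB => //; exact: cvg_cst.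
have zt_cvg1 i : (zt t).1 i 0 @[t --> G] --> (zt ts).1 i 0.
  have ztE t : (zt t).1 i 0 = (1 - t) * z.1 i 0 + t * q.1 i 0 by rewrite !mxE.
  by rewrite ztE; under eq_fun do rewrite ztE; exact: comb_cvg.
have zt_cvg2 i : (zt t).2 i 0 @[t --> G] --> (zt ts).2 i 0.
  have ztE t : (zt t).2 i 0 = (1 - t) * z.2 i 0 + t * q.2 i 0 by rewrite !mxE.
  by rewrite ztE; under eq_fun do rewrite ztE; exact: comb_cvg.
have normal_cvg1 i : (normal (S t).2).1 i 0 @[t --> G] --> (- g) i 0.
  rewrite mxE; under eq_fun do rewrite mxE.
  exact: cvgN.
have valid_g : valid (- g, b).
  move=> c Cc; apply: (le_lim (fun t => pdot (normal (S t).2) c)).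
    by apply: cvg_pdot => // i; exact: cvg_cst.
  by move=> t /SP[_ s1 _]; exact: valid_normal.
pose s : V := (x, b).
(* If [p] were positive at [s], adding a small multiple of [normal b0] would make it negative at
   [zt ts] and leave it positive at [s]. Both signs persist for [t] near [ts], against the choice of
   [S t]. *)
have valid_s p : valid p -> pdot p s <= 0.
  move=> vp; rewrite leNgt; apply/negP => ps.
  pose D := `|pdot (normal b0) s|; have D0 : 0 <= D by exact: normr_ge0.
  pose e := pdot p s / (1 + D).
  have e0 : 0 < e by rewrite divr_gt0 //; lra.
  have eD : e * (1 + D) = pdot p s by rewrite divfK // gt_eqF //; lra.
  pose p' := p + e *: normal b0.
  have vp' : valid p'.
    move=> w Cw; have := vp w Cw; have := valid_normal b01 Cw.
    by rewrite !pdotE; nra.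
  have p's : 0 < pdot p' s.
    have : - D <= pdot (normal b0) s by rewrite lerNl /D -normrN ler_norm.
    by rewrite !pdotE; nra.
  have p'z : pdot p' (zt ts) < 0.
    have := vp _ Czts; have := nq b0 b01.
    have ets : 0 < e * ts by rewrite mulr_gt0.
    by rewrite [pdot p' _]pdotDl pdotZl nzt b0z; nra.
  have c1 : pdot p' (S t) @[t --> G] --> pdot p' s.
    by apply: cvg_pdot => // i; exact: cvg_cst.
  have c2 : pdot p' (zt t) @[t --> G] --> pdot p' (zt ts).
    by apply: cvg_pdot => // i; exact: cvg_cst.
  have G1 : G [set t | 0 < pdot p' (S t)] by exact: (cvgr_gt _ c1 _ p's).
  have G2 : G [set t | pdot p' (zt t) < 0] by exact: (cvgr_lt _ c2 _ p'z).
  have [t [[/= t1 t2] /SP[_ _ h]]] := filter_ex (filterI (filterI G1 G2) Gt).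
  have : pdot p' (S t) < 0.
    apply: h => //; last exact: ltW.
    by apply: contraTneq t2 => ->; rewrite pdotC /pdot !dotp0 addr0 ltxx.
  by rewrite ltNge (ltW t1).
have Cs : C s by rewrite /C CsetE => b' /valid_normal; exact: valid_s.
(* Validity of [normal b] at [s] gives [1 <= dotp (Gamma b) x] with [x] in the unit ball; [valid_g]
   then identifies [g] in the same way. *)
have xG : x = Gamma b.
  apply: sphere_dotp_ge1 => //; first exact: Gamma_sphere.
  have := valid_s _ (valid_normal b1).
  by move/sphereP: b1; rewrite pdot_normal /= => ->; lra.
have gG : g = Gamma b.
  apply: sphere_dotp_ge1 => //; first exact: Gamma_sphere.
  have := valid_s _ valid_g.
  by move/sphereP: b1; rewrite /pdot /= xG dotpNl dotpC => ->; lra.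
(* By symmetry this value equals that of [normal b0] at [s]. *)
have bz : pdot (normal b) z <= 0.
  have := valid_s _ (valid_normal b01); rewrite !pdot_normal /= xG.
  by rewrite (dotpC b0) (dotpC (Gamma b0)).
(* For [t] before [ts], if [normal (S t).2] were negative at [zt t], it would be negative at [S t],
   against Cauchy-Schwarz. *)
have : 0 <= pdot (normal b) (zt ts).
  apply: (ge_lim (fun t => pdot (normal (S t).2) (zt t))).
    have -> : normal b = (- g, b) by rewrite gG.
    exact: cvg_pdot.
  move=> t t01; have [s1 s2 sP] := SP t t01; rewrite leNgt; apply/negP => h.
  have := sP _ (normal_neq0 Gamma s2) (valid_normal s2) (ltW h).
  have := dotp_le_enorm (Gamma (S t).2) (S t).1.
  rewrite pdot_normal (Gamma_sphere s2) mul1r.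
  by move/sphereP: s2 => ->; lra.
(* [zt ts] mixes [z], where [normal b] is nonpositive, with a positive share of [q], where it is
   negative. *)
by have := nq b b1; rewrite nzt; nra.
Unshelve. all: by end_near.
Qed.

End Nonexpansive.

(** * Homogeneous extension of Gamma *)

Lemma continuous_of_lipschitz (R : realType) (f : R -> R) (K : R) :
  (forall x y, `|f x - f y| <= K * `|x - y|) -> continuous f.
Proof.
move=> fK x; apply/cvgrPdist_le => e e0.
have K0 : 0 <= K.
  by have := le_trans (normr_ge0 _) (fK 1 0); rewrite subr0 normr1 mulr1.
have K1 : 0 < K + 1 by lra.
have /cvgrPdist_le near_le_e : y @[y --> x] --> x by exact: cvg_id.
near=> y; apply: le_trans (fK x y) _.
have : `|x - y| <= e / (K + 1).
  by near: y; apply: near_le_e; exact: divr_gt0.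
rewrite ler_pdivlMr //; have := normr_ge0 (x - y); nra.
Unshelve. all: by end_near.
Qed.

Section Homogeneous.
Variables (R : realType) (n m : nat) (Gamma : 'cV[R]_m -> 'cV[R]_n).
Hypothesis Gamma_sphere : forall b, sphere b -> sphere (Gamma b).
Hypothesis Gamma_nonexp :
  forall b b', sphere b -> sphere b' -> dotp b b' <= dotp (Gamma b) (Gamma b').
Implicit Types (u v w : 'cV[R]_m).

(* Along the positively homogeneous extension, the arc of the sphere from a unit
   vector to [- d] can be replaced by a straight segment. *)
Definition hom_ext v := enorm v *: Gamma ((enorm v)^-1 *: v).

Lemma sphere_normalize k (v : 'cV[R]_k) : v != 0 -> sphere ((enorm v)^-1 *: v).
Proof.
rewrite -enorm_eq0 => v0; rewrite /sphere /= enormZ normfV.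
by rewrite ger0_norm ?enorm_ge0 // mulVf.
Qed.

Lemma enorm_scale_normalize k (v : 'cV[R]_k) : v != 0 ->
  v = enorm v *: ((enorm v)^-1 *: v).
Proof. by rewrite -enorm_eq0 => v0; rewrite scalerA divff // scale1r. Qed.

Lemma hom_ext0 : hom_ext 0 = 0.
Proof.
rewrite /hom_ext; have -> : enorm (0 : 'cV[R]_m) = 0 by apply/eqP; rewrite enorm_eq0.
by rewrite scale0r.
Qed.

Lemma hom_ext_dotpp v : dotp (hom_ext v) (hom_ext v) = dotp v v.
Proof.
have [->|v0] := eqVneq v 0; first by rewrite hom_ext0 !dotp0.
have /sphereP := Gamma_sphere (sphere_normalize v0).
by rewrite dotpZl dotpZr => ->; rewrite mulr1 -sqr_enorm expr2.
Qed.

Lemma hom_ext_dotp v w : dotp v w <= dotp (hom_ext v) (hom_ext w).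
Proof.
have [->|v0] := eqVneq v 0; first by rewrite hom_ext0 dotpC dotp0 dotpC dotp0.
have [->|w0] := eqVneq w 0; first by rewrite hom_ext0 !dotp0.
have v1 := sphere_normalize v0; have w1 := sphere_normalize w0.
move: (enorm_scale_normalize v0) (enorm_scale_normalize w0) v1 w1; rewrite /hom_ext.
set v' := _ *: v; set w' := _ *: w => vE wE v1 w1; clearbody v' w'.
rewrite [X in dotp X w]vE [X in dotp _ X <= _]wE !(dotpZl, dotpZr).
by rewrite !ler_wpM2l ?enorm_ge0 // Gamma_nonexp.
Qed.

(** Lengths are preserved and products do not decrease, so distances do not increase. *)
Lemma hom_ext_lipschitz v w : enorm (hom_ext v - hom_ext w) <= enorm (v - w).
Proof.
rewrite le_enorm !(dotpDl, dotpDr, dotpNl, dotpNr) !hom_ext_dotpp.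
rewrite (dotpC (hom_ext w)) (dotpC w); have := hom_ext_dotp v w; lra.
Qed.

End Homogeneous.

(** * Normals from [Gset] that are nonnegative at a point of [Qg] *)

Section Hyperplane.
Variables (R : realType) (n m : nat) (Gamma : 'cV[R]_m -> 'cV[R]_n).
Variables (a : 'cV[R]_n) (d : 'cV[R]_m).
Hypothesis Gamma_sphere : forall b, sphere b -> sphere (Gamma b).
Hypothesis Gamma_nonexp :
  forall b b', sphere b -> sphere b' -> dotp b b' <= dotp (Gamma b) (Gamma b').
Hypothesis a_le1 : enorm a <= 1.
Hypothesis d_sphere : sphere d.
Local Notation V := ('cV[R]_n * 'cV[R]_m)%type.
Implicit Types (p z w q s : V) (c t : R) (b : 'cV[R]_m).

Let ad : V := (a, d).
Let hext := hom_ext Gamma.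

Lemma sphereN b : sphere b -> sphere (- b).
Proof. by move=> /sphereP b1; apply/sphereP; rewrite dotpNl dotpNr opprK. Qed.

(** Each summand changes by at most [enorm (y + d)] times the change of [t], since [hext] is
    1-Lipschitz and [a], [d] lie in the unit ball. *)
Lemma path_lipschitz (y : 'cV[R]_m) :
  continuous (fun t : R => dotp a (hext ((1 - t) *: y - t *: d)) +
    dotp d ((1 - t) *: y - t *: d)).
Proof.
apply: (@continuous_of_lipschitz _ _ (2 * enorm (y + d))) => t t'.
rewrite /=; set v := (1 - t) *: y - t *: d; set v' := (1 - t') *: y - t' *: d.
have vv' : enorm (v - v') = `|t - t'| * enorm (y + d).
  rewrite -enormZ -enormN; congr enorm.
  by apply/matrixP => i j; rewrite !mxE; ring.
have le_u k (c u : 'cV[R]_k) : enorm c <= 1 -> `|dotp c u| <= enorm u.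
  move=> c1; have cu := ler_piMl (enorm_ge0 u) c1.
  rewrite ler_norml; have := dotp_le_enorm c u; have := dotp_le_enorm c (- u).
  by rewrite dotpNr enormN; lra.
have -> : dotp a (hext v) + dotp d v - (dotp a (hext v') + dotp d v') =
    dotp a (hext v - hext v') + dotp d (v - v').
  by rewrite !(dotpDr, dotpNr); ring.
apply: le_trans (ler_normD _ _) _.
have h1 := le_u _ a (hext v - hext v') a_le1.
have h2 := le_u _ d (v - v') (sphere_enorm_le1 d_sphere).
have h3 := hom_ext_lipschitz Gamma_sphere Gamma_nonexp v v'.
rewrite -/hext in h3; rewrite vv' in h2 h3; lra.
Qed.

(** If the direction of [y] lies in [Gset], Cauchy-Schwarz suffices. Otherwise the segment from [y]
    to [- d] has a point [v] where the condition of [Gset] is an equality, and this equality gives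
    the bound. *)
Lemma Qg_violates z : Qh z -> pdot ad z = -1 ->
  exists2 b, Gset Gamma a d b & 0 <= pdot (normal Gamma b) z.
Proof.
move=> Qz Hz; set x := z.1; set y := z.2.
have xy : enorm x <= enorm y by [].
have y0 : y != 0.
  apply/eqP => y0; have /eqP : enorm x = 0.
    apply/eqP; rewrite eq_le enorm_ge0 andbT.
    by have /eqP <- : enorm y == 0 by rewrite enorm_eq0 y0.
  rewrite enorm_eq0 => /eqP x0; move: Hz.
  by rewrite /pdot -/x -/y x0 y0 !dotp0; lra.
have Hxy : dotp a x + dotp d y = -1 by [].
have yn := enorm_ge0 y; have xn := enorm_ge0 x.
(* It is enough to find an unnormalised [v]: both conditions are homogeneous. *)
have normalize v : v != 0 -> dotp a (hext v) + dotp d v <= 0 ->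
    0 <= - dotp (hext v) x + dotp v y ->
    exists2 b, Gset Gamma a d b & 0 <= pdot (normal Gamma b) z.
  move=> v0; have vn : 0 < enorm v by rewrite lt_def enorm_ge0 enorm_eq0 v0.
  have b1 := sphere_normalize v0; have bv := enorm_scale_normalize v0.
  move: b1 bv; rewrite /hext /hom_ext; set b := _^-1 *: v => b1 bv; clearbody b.
  rewrite [X in dotp d X]bv [X in dotp X y]bv !(dotpZl, dotpZr) => h1 h2.
  exists b; first by split=> //; rewrite -(pmulr_rle0 _ vn) mulrDr.
  by rewrite pdot_normal -(pmulr_rge0 _ vn) mulrDr mulrN.
pose f t := dotp a (hext ((1 - t) *: y - t *: d)) +
    dotp d ((1 - t) *: y - t *: d).
have hy : enorm (hext y) = enorm y.
  by apply/eqP; rewrite eq_le !le_enorm hom_ext_dotpp ?lexx.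
have [fy|fy] := leP (dotp a (hext y) + dotp d y) 0.
  apply: (normalize y) => //.
  have := dotp_le_enorm (hext y) x; rewrite hy -sqr_enorm; nra.
have f0 : 0 < f 0 by rewrite /f subr0 scale1r scale0r subr0.
(* At the end [- d] of the segment the value is at most [enorm a - 1]. *)
have f1 : f 1 <= 0.
  rewrite /f subrr scale0r sub0r scale1r dotpNr.
  have -> : dotp d d = 1 by apply/sphereP.
  have := dotp_le_enorm a (hext (- d)).
  have -> : enorm (hext (- d)) = 1.
    apply/eqP; rewrite -(@eqrXn2 _ 2) ?enorm_ge0 // sqr_enorm hom_ext_dotpp //.
    by rewrite dotpNl dotpNr opprK expr1n; apply/eqP/sphereP.
  by rewrite mulr1 subr_le0 => /le_trans; apply.
have [t] : exists2 t, t \in `[0, 1] & f t = 0.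
  apply: IVT => //; last by rewrite ge_min le_max f1 (ltW f0) orbT.
  by apply: continuous_subspaceT; exact: path_lipschitz.
rewrite in_itv /= => /andP[t0 t1]; rewrite /f; set v := (1 - t) *: y - t *: d => ft.
have dd : dotp d d = 1 by apply/sphereP.
have vy : dotp v y = (1 - t) * enorm y ^+ 2 + t * (1 + dotp a x).
  rewrite sqr_enorm /v !(dotpDl, dotpNl, dotpZl).
  have -> : dotp d y = - 1 - dotp a x by lra.
  by ring.
(* After squaring, [ft] makes the cross terms agree, and [hext v] has the length of [v]; what
   remains is [dotp a a <= 1]. *)
have tv : enorm (t *: a - hext v) <= (1 - t) * enorm y.
  have -> : (1 - t) * enorm y = enorm (t *: d + v).
    by rewrite [_ + v]addrC /v subrK enormZ ger0_norm // subr_ge0.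
  have : dotp (hext v) (hext v) = dotp v v by exact: hom_ext_dotpp.
  clearbody v; move: (hext v) ft => w ft ww.
  rewrite le_enorm !(dotpDl, dotpDr, dotpNl, dotpNr, dotpZl, dotpZr) ww.
  rewrite dd (dotpC w) (dotpC v d).
  have aa : dotp a a <= 1 by rewrite -sqr_enorm expr_le1 ?enorm_ge0.
  have taa := ler_wpM2l t0 (ler_wpM2l t0 aa).
  have tft : t * dotp a w + t * dotp d v = 0 by rewrite -mulrDr ft mulr0.
  lra.
(* By [vy] the right side is [dotp (t *: a - hext v) x + (1 - t) * enorm y ^+ 2 + t]; [tv] and [xy]
   make the first two terms sum to at least [0]. *)
have pz : t <= - dotp (hext v) x + dotp v y.
  rewrite vy; have := dotp_le_enorm (t *: a - hext v) (- x).
  rewrite enormN dotpNr dotpDl dotpZl dotpNl => h.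
  have : enorm (t *: a - hext v) * enorm x <= (1 - t) * enorm y * enorm y.
    by apply: ler_pM; rewrite ?enorm_ge0.
  by move: h; rewrite expr2; nra.
apply: (normalize v); [|by rewrite ft|exact: le_trans pz].
(* [v = 0] would force [t = 0], hence [v = y]. *)
apply/eqP => v0; move: pz; rewrite v0 /hext hom_ext0 dotpC dotp0 dotpC dotp0 => pz.
have t00 : t = 0 by lra.
by move: v0 y0; rewrite /v t00 subr0 scale1r scale0r subr0 => ->; rewrite eqxx.
Qed.

End Hyperplane.

(** * Sections by the hyperplane *)

Lemma dim_colpair (R : realType) (n m : nat) :
  dim ('cV[R]_n * 'cV[R]_m)%type = (n + m)%N.
Proof.
have dim_col k : dim 'cV[R]_k = k by rewrite dim_matrix [LHS]mulr1.
exact: (congr2 addn (dim_col n) (dim_col m)).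
Qed.

Lemma full_dim_aff_hull (R : realType) (n m : nat)
    (C : set ('cV[R]_n * 'cV[R]_m)) : full_dim C -> aff_hull C = setT.
Proof.
move=> [x0 [U [dU CU]]].
have UT : U = fullv.
  by apply/eqP; rewrite eqEdim subvf dimvf dU dim_colpair leqnn.
by rewrite CU UT; apply/seteqP; split=> // x _ /=; rewrite memvf.
Qed.

Section HyperplaneSection.
Variables (R : realType) (n m : nat).
Local Notation V := ('cV[R]_n * 'cV[R]_m)%type.
Variable ad : V.
Implicit Types (z w : V) (K : set V).
Local Notation H := [set z | pdot ad z = -1].

Lemma pdot_is_linear : linear (pdot ad : V -> R^o).
Proof. by move=> c x y; rewrite pdotDr pdotZr. Qed.

HB.instance Definition _ :=
  GRing.isLinear.Build R V R^o *:%R (pdot ad : V -> R^o) pdot_is_linear.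

Lemma aff_hull_sub K : K `<=` H -> aff_hull K `<=` H.
Proof.
move=> KH z [k [x [l [Kx l1 ->]]]] /=; rewrite pdot_sum.
under eq_bigr => i _ do rewrite (KH _ (Kx i)) mulrN1.
by rewrite sumrN l1.
Qed.

(** A point [z] of [H] lies on the line from [z0] through a nearby point of [K]. *)
Lemma aff_hull_section K z0 : K `<=` H -> H z0 ->
  (\forall w \near (0 : V), H (z0 + w) -> K (z0 + w)) -> aff_hull K = H.
Proof.
move=> KH Hz0 Kz0; apply/seteqP; split; first exact: aff_hull_sub.
move=> z Hz; have [e e0 Ke] := near0_dir (z - z0) Kz0.
have He : H (z0 + e *: (z - z0)).
  by rewrite /= !pdotE (Hz : pdot ad z = -1) (Hz0 : pdot ad z0 = -1); ring.
have K0 : K z0 by have := nbhs_singleton Kz0; rewrite addr0; exact.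
have -> : z = z0 + e^-1 *: (z0 + e *: (z - z0) - z0).
  by rewrite [z0 + e *: _]addrC addrK scalerA mulVf ?gt_eqF // scale1r addrC subrK.
by apply: aff_hull_line => //; exact: Ke.
Qed.

(** The hull is [H], a translate of the kernel of a nonzero functional; rank-nullity gives the
    dimension. *)
Lemma has_dim_section K z0 : ad != 0 -> K `<=` H -> H z0 ->
  (\forall w \near (0 : V), H (z0 + w) -> K (z0 + w)) -> has_dim K (n + m - 1).
Proof.
move=> ad0 KH Hz0 Kz0.
exists z0, (lker (linfun (pdot ad : V -> R^o))); split; last first.
  rewrite (aff_hull_section KH Hz0 Kz0); apply/seteqP.
  split=> z /=; rewrite memv_ker lfunE /= pdotE pdotNr (Hz0 : pdot ad z0 = -1) opprK.
    by move=> ->; rewrite addNr.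
  by rewrite addr_eq0 => /eqP.
set f := linfun _.
have := limg_ker_dim f fullv; rewrite capfv dimvf.
have -> : dim V = (n + m)%N by exact: dim_colpair.
have -> : \dim (limg f) = 1%N; last by move=> <-; rewrite addnK.
apply/eqP; rewrite eqn_leq; apply/andP; split.
  have := dimvS (subvf (limg f)); rewrite [X in (_ <= X)%N]dimvf.
  by [].
rewrite lt0n dimv_eq0; apply/eqP => f0.
have : f ad \in limg f by apply: memv_img; exact: memvf.
rewrite f0 memv0 lfunE /= => /eqP h.
by have := pdotpp_gt0 ad0; rewrite h ltxx.
Qed.

End HyperplaneSection.

(** * Freeness and maximality of the section *)

Section Main.
Variables (R : realType) (n m : nat) (Gamma : 'cV[R]_m -> 'cV[R]_n).
Variables (a : 'cV[R]_n) (d : 'cV[R]_m).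
Hypothesis Gamma_sphere : forall b, sphere b -> sphere (Gamma b).
Local Notation V := ('cV[R]_n * 'cV[R]_m)%type.
Local Notation C := (Cset Gamma (@sphere R m)).
Local Notation K := (Cset Gamma (Gset Gamma a d) `&` hyperplane a d).
Local Notation ad := ((a, d) : V).
Hypothesis C_ray : forall b, sphere b -> C (Gamma b, b).
Hypothesis a_le1 : enorm a <= 1.
Hypothesis d_sphere : sphere d.
Implicit Types (p z w q s : V) (c t : R) (b : 'cV[R]_m).

Lemma ray_nonexp b b' : sphere b -> sphere b' ->
  dotp b b' <= dotp (Gamma b) (Gamma b').
Proof.
move=> b1 b1'; have := C_ray b1'; rewrite CsetE => /(_ b b1).
by rewrite pdot_normal /=; lra.
Qed.

Lemma Cset_sub_G : C `<=` Cset Gamma (Gset Gamma a d).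
Proof. by move=> z Cz b [b1 _]; exact: Cz. Qed.

Lemma core_translate (D : set V) q w : (forall x y, D x -> D y -> D (x + y)) ->
  (\forall v \near (0 : V), D (q + v)) -> D w ->
  \forall v \near (0 : V), D (q + w + v).
Proof.
by move=> DD Dq Dw; apply: filterS Dq => v Dqv; rewrite addrAC; exact: DD.
Qed.

Lemma core_scale (D : set V) q c : (forall c x, 0 <= c -> D x -> D (c *: x)) ->
  0 < c -> (\forall v \near (0 : V), D (q + v)) ->
  \forall v \near (0 : V), D (c *: q + v).
Proof.
move=> DZ c0 Dq; apply: filterS (near0_scale c^-1 Dq) => v Dqv.
have -> : c *: q + v = c *: (q + c^-1 *: v).
  by rewrite scalerDr scalerA divff ?gt_eqF // scale1r.
by apply: DZ => //; exact: ltW.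
Qed.

(** By the equality case of Cauchy-Schwarz, [pdot ad] is negative at [r] when [a] differs from
    [Gamma (- d)]. Moving [q] far along [r], which lies in [C], makes [pdot ad] negative, and a
    positive scaling reaches [H]. *)
Lemma slater q : a <> Gamma (- d) -> (\forall w \near (0 : V), C (q + w)) ->
  exists2 z0, pdot ad z0 = -1 & \forall w \near (0 : V), C (z0 + w).
Proof.
move=> aG Cq; have d1 := sphereN d_sphere.
pose r : V := (Gamma (- d), - d).
have kap : pdot ad r < 0.
  rewrite /pdot /= dotpNr; have -> : dotp d d = 1 by apply/sphereP.
  rewrite subr_lt0 ltNge; apply/negP => h; apply: aG.
  by apply: sphere_dotp_ge1 => //; [exact: Gamma_sphere|rewrite dotpC].
pose h := pdot ad q.
pose M := (`|h| + 1) / - pdot ad r.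
have M0 : 0 <= M by rewrite divr_ge0 ?addr_ge0 // oppr_ge0 ltW.
have Mk : M * pdot ad r = - (`|h| + 1).
  by apply/eqP; rewrite -eqr_oppLR -mulrN divfK // oppr_eq0 lt_eqF.
have val : pdot ad (q + M *: r) < 0.
  by rewrite !pdotE Mk; have := ler_norm h; rewrite -/h; lra.
exists ((- pdot ad (q + M *: r))^-1 *: (q + M *: r)).
  by rewrite pdotZr invrN mulNr mulVf // lt_eqF.
apply: core_scale; [by move=> *; exact: CsetZ|by rewrite invr_gt0 oppr_gt0|].
apply: core_translate => //; first by move=> *; exact: CsetD.
by apply: CsetZ => //; exact: C_ray.
Qed.

Lemma near_section z0 : (\forall w \near (0 : V), C (z0 + w)) ->
  \forall w \near (0 : V), hyperplane a d (z0 + w) -> K (z0 + w).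
Proof. by apply: filterS => w Cw Hw; split=> //; exact: Cset_sub_G. Qed.

Lemma ad_neq0 : ad != 0.
Proof.
apply/eqP => -[_ d0]; move/sphereP: d_sphere.
by rewrite d0 dotp0 => /esym/eqP; rewrite oner_eq0.
Qed.

Lemma section_full_dim z0 : pdot ad z0 = -1 ->
  (\forall w \near (0 : V), C (z0 + w)) -> full_dim_in_hyperplane a d K.
Proof.
move=> Hz0 Cz0; split; first by move=> z [].
apply: (@has_dim_section _ _ _ ad _ z0) => //; first exact: ad_neq0.
exact: near_section Cz0.
Qed.

Lemma section_Qg_free z0 : pdot ad z0 = -1 ->
  (\forall w \near (0 : V), C (z0 + w)) -> Qg_free a d K.
Proof.
move=> Hz0 Cz0; split.
- exact: section_full_dim Cz0.
- apply: closedI; first by rewrite Cset_cone_of; exact: closed_cone_of.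
  rewrite (_ : hyperplane a d = pdot ad @^-1` [set x | x = -1]) //.
  by apply: closed_comp; [move=> z _; exact: pdot_continuous|exact: closed_eq].
- have cG : convex_set (Cset Gamma (Gset Gamma a d) : set (convex_lmodType V)).
    by rewrite Cset_cone_of; exact: convex_cone_of.
  apply/convex_set_comb => x y t t0 t1 [Gx Hx] [Gy Hy].
  split; first by move/convex_set_comb: cG; apply.
  have : pdot ad (t *: x + (1 - t) *: y) = -1; last exact.
  by rewrite !pdotE (Hx : pdot ad x = -1) (Hy : pdot ad y = -1); ring.
apply/seteqP; split=> // z [[Kz nKz] [Qz Hz]].
have [b Gb bz] := Qg_violates Gamma_sphere ray_nonexp a_le1 d_sphere Qz Hz.
have K0 : K z0.
  by have := nbhs_singleton (near_section Cz0); rewrite addr0; exact.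
have bz0 : pdot (normal Gamma b) z0 < 0.
  have /pdotpp_gt0 pp := normal_neq0 Gamma Gb.1.
  have [e e0] := near0_dir (normal Gamma b) Cz0; rewrite CsetE => /(_ b Gb.1).
  by rewrite !pdotE; nra.
have nKz0 : \forall w \near (0 : V), aff_hull K (z + w) -> K (z + w).
  have : (fun w : V => z + w) @ (0 : V) --> z + 0.
    by apply: cvgD; [exact: cvg_cst|exact: cvg_id].
  by rewrite addr0 => /(_ _ nKz).
(* [normal b] is negative at [z0] and nonnegative at [z], hence positive just beyond [z] on the line
   from [z0], where points still belong to [K]. *)
have [e e0 Ke] := near0_dir (z - z0) nKz0.
have : K (z + e *: (z - z0)).
  by apply: Ke; rewrite -opprB scalerN -scaleNr; exact: aff_hull_line.
rewrite CsetE => -[/(_ b Gb)].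
by rewrite !pdotE; nra.
Qed.

(** The terms in the square of [T] cancel, [b] and [Gamma b] being unit vectors, so the gap between
    the squared norms grows linearly in [T]. *)
Lemma Qh_add_ray b y : sphere b -> 0 < pdot (normal Gamma b) y ->
  exists2 T, 0 <= T & Qh (y + T *: ((Gamma b, b) : V)).
Proof.
move=> b1; rewrite pdot_normal; set A := _ + _ => A0.
have N0 := dotpp_ge0 y.1; have y2 := dotpp_ge0 y.2.
exists (dotp y.1 y.1 / A); first by rewrite divr_ge0 // ltW.
have : dotp y.1 y.1 / A * A = dotp y.1 y.1 by rewrite divfK // gt_eqF.
move: (_ / A) => T; rewrite /A => TA.
apply/Qh_dotp; rewrite /= !(dotpDl, dotpDr, dotpZl, dotpZr).
have -> : dotp (Gamma b) (Gamma b) = 1 by apply/sphereP/Gamma_sphere.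
have -> : dotp b b = 1 by apply/sphereP.
rewrite (dotpC y.1 (Gamma b)) (dotpC y.2 b); lra.
Qed.

(** The point [s] of [Qg] is a proper convex combination of [z], in [K'] but not in [K], and of [k],
    interior to the cone [D]; by convexity a neighbourhood of [s] in [H] lies in [K']. *)
Lemma section_maximal z0 : pdot ad z0 = -1 ->
  (\forall w \near (0 : V), C (z0 + w)) ->
  forall K', Qg_free a d K' -> ~ (K `<` K').
Proof.
move=> Hz0 Cz0 K' [[K'H _] _ /convex_set_comb K'c K'free] [KK' nK'K].
have [z [K'z nKz]] : exists z, K' z /\ ~ K z.
  apply: contrapT => h; apply: nK'K => z K'z; apply: contrapT => nKz.
  by apply: h; exists z.
have Hz : pdot ad z = -1 by exact: K'H.
have [b [[b1 Gb] bz]] : exists b, Gset Gamma a d b /\ 0 < pdot (normal Gamma b) z.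
  apply: contrapT => h; apply: nKz; split=> //; rewrite CsetE => b Gb.
  by rewrite leNgt; apply/negP => bz; apply: h; exists b.
pose D := Cset Gamma (Gset Gamma a d).
have DD x y : D x -> D y -> D (x + y) by exact: CsetD.
have DZ c x : 0 <= c -> D x -> D (c *: x) by exact: CsetZ.
have Dz0 : \forall w \near (0 : V), D (z0 + w).
  by apply: filterS Cz0 => w; exact: Cset_sub_G.
pose r : V := (Gamma b, b).
have Dr : D r by exact/Cset_sub_G/C_ray.
pose kappa := - pdot ad r; have kappa0 : 0 <= kappa by rewrite oppr_ge0.
(* A little of [z0] keeps [normal b] positive, and makes [k] interior to [D]. *)
have [eta eta0 bzeta] : exists2 eta,
    0 < eta & 0 < pdot (normal Gamma b) (z + eta *: z0).
  set A := pdot _ z in bz; pose B := `|pdot (normal Gamma b) z0|.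
  have B0 : 0 <= B by exact: normr_ge0.
  have B1 : 0 < 1 + B by lra.
  exists (A / (1 + B)); first by rewrite divr_gt0.
  have eB : A / (1 + B) * (1 + B) = A by rewrite divfK // gt_eqF.
  have e0 : 0 < A / (1 + B) by rewrite divr_gt0.
  have : - B <= pdot (normal Gamma b) z0 by rewrite lerNl /B -normrN ler_norm.
  by rewrite !pdotE -/A; nra.
set y := z + eta *: z0 in bzeta.
have [T T0 Ty] := Qh_add_ray b1 bzeta.
(* [pdot ad] takes the value [- (1 + sigma)] at [y + T *: r], so dividing by [1 + sigma] lands in
   [H]. *)
pose sigma := eta + T * kappa.
have sigma0 : 0 < sigma by rewrite ltr_pwDl // mulr_ge0.
pose k := sigma^-1 *: (eta *: z0 + T *: r).
have Dk : \forall w \near (0 : V), D (k + w).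
  apply: core_scale => //; first by rewrite invr_gt0.
  by apply: core_translate => //; [exact: core_scale|exact: DZ].
have Hk : pdot ad k = -1.
  rewrite !pdotE Hz0; have -> : pdot ad r = - kappa by rewrite opprK.
  by rewrite mulrN1 mulrN -opprD mulrN mulVf // gt_eqF.
pose t := (1 + sigma)^-1.
have s1 : 0 < 1 + sigma by lra.
have t0 : 0 < t by rewrite invr_gt0.
have ts : t * (1 + sigma) = 1 by rewrite mulVf // gt_eqF.
have t1 : 1 - t = t * sigma by rewrite -[X in X - _]ts; ring.
pose s := t *: (y + T *: r).
have sE : s = t *: z + (1 - t) *: k.
  rewrite t1 /k scalerA mulrAC -mulrA mulVf ?gt_eqF // mulr1.
  by rewrite -scalerDr addrA.
have Qs : Qh s by rewrite /Qh /= !enormZ; apply: ler_wpM2l.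
clearbody k s.
have Hs : pdot ad s = -1 by rewrite sE !pdotE Hz Hk; ring.
have t11 : 0 < 1 - t by rewrite t1 mulr_gt0.
(* The whole perturbation of [s] is charged to [k]. *)
have K's : \forall w \near (0 : V), hyperplane a d (s + w) -> K' (s + w).
  apply: filterS (near0_scale (1 - t)^-1 Dk) => w Dw Hw.
  have -> : s + w = t *: z + (1 - t) *: (k + (1 - t)^-1 *: w).
    by rewrite scalerDr scalerA divff ?gt_eqF // scale1r addrA -sE.
  apply: K'c => //; [exact: ltW|lra|apply: KK'; split=> //].
  have : pdot ad (k + (1 - t)^-1 *: w) = -1; last exact.
  have : pdot ad (s + w) = -1 by [].
  rewrite !pdotDr pdotZr Hs Hk => h.
  by rewrite (_ : pdot ad w = 0) ?mulr0 ?addr0 //; lra.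
have : (relint K' `&` Qg a d) s; last by rewrite K'free.
split; last by split.
split.
  by have := nbhs_singleton K's; rewrite addr0; apply.
have ws : (fun w : V => w - s) @ s --> (0 : V).
  rewrite -(subrr s); apply: cvgB; [exact: cvg_id|exact: cvg_cst].
have near_s : \forall w \near s,
    hyperplane a d (s + (w - s)) -> K' (s + (w - s)) := ws _ K's.
apply: filterS near_s => w; rewrite addrC subrK => h hullw.
by apply: h; exact: (@aff_hull_sub _ _ _ ad K' K'H w hullw).
Qed.

End Main.

Theorem theorem4 (R : realType) (n m : nat) (a : 'cV[R]_n) (d : 'cV[R]_m)
    (Gamma : 'cV[R]_m -> 'cV[R]_n) (n_ge1 : (1 <= n)%N) (m_ge1 : (1 <= m)%N)
    (max_ad : Num.max (enorm a) (enorm d) = 1)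
    (le_ad : enorm a <= enorm d) (norm_d : enorm d = 1)
    (Gamma_sphere : forall b, sphere b -> sphere (Gamma b))
    (C_full : full_dim (Cset Gamma (@sphere R m)))
    (C_maximal : maximal_Qh_free (Cset Gamma (@sphere R m))) :
  (full_dim_in_hyperplane a d
     (Cset Gamma (Gset Gamma a d) `&` hyperplane a d) /\
   maximal_Qg_free a d
     (Cset Gamma (Gset Gamma a d) `&` hyperplane a d))
  <-> a <> Gamma (- d).
Proof.
have a_le1 : enorm a <= 1 by rewrite -norm_d.
split=> [[[_ [x0 [U [_ Khull]]]] _] aE | aG].
  have : aff_hull (Cset Gamma (Gset Gamma a d) `&` hyperplane a d) x0.
    by rewrite Khull /= subrr mem0v.
  move=> [k [p [l [Kp l1 _]]]].
  (* Weights summing to [1] cannot form an empty family, so the section has a point. *)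
  case: k p l Kp l1 => [p l _|k p l Kp _].
    by rewrite big_ord0 => /esym/eqP; rewrite oner_eq0.
  have [/(_ (- d))] := Kp ord0; rewrite -aE.
  have d1 : sphere (- d) by exact: sphereN.
  (* For [- d] the condition of [Gset] reads [dotp a a <= 1]. *)
  have Gd : Gset Gamma a d (- d).
    split=> //; rewrite -aE dotpNr -!sqr_enorm norm_d expr1n subr_le0.
    by rewrite expr_le1 ?enorm_ge0.
  move=> /(_ Gd); rewrite dotpNl -opprD /hyperplane /= => h1 h2.
  by move: h1; rewrite h2; lra.
have [q Cq] : exists q, \forall w \near (0 : 'cV[R]_n * 'cV[R]_m),
    Cset Gamma (@sphere R m) (q + w).
  apply: cone_core; [exact: Cset0|by move=> x y; exact: CsetD|
    by move=> c x; exact: CsetZ|exact: full_dim_aff_hull].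
have C_ray := maximal_ray Gamma_sphere Cq C_maximal.
have [z0 Hz0 Cz0] := slater Gamma_sphere C_ray a_le1 norm_d aG Cq.
split; first exact: section_full_dim Hz0 Cz0.
split; first exact: (section_Qg_free Gamma_sphere C_ray a_le1 norm_d Hz0 Cz0).
exact: (section_maximal Gamma_sphere C_ray Hz0 Cz0).
Qed.
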